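(* Let $\mathbb{F}$ be a field with a non-identity involution $x\mapsto x^\star$, and $\mathbb{K}=\{x\in\mathbb{F}:x^\star=x\}$. Let $V$ be an $n$-dimensional $\mathbb{F}$-vector space and $b$ a non-degenerate Hermitian form on $V$ with Witt index $\nu$. Let $\mathcal{V}$ be a $\mathbb{K}$-linear subspace of $\mathcal{H}_b$ consisting of nilpotent endomorphisms. Then $\dim_{\mathbb{K}}\mathcal{V}\le \nu(2n-2\nu-1)$. If moreover $|\mathbb{F}|>4$ and $\dim_{\mathbb{K}}\mathcal{V}=\nu(2n-2\nu-1)$, then there exists a maximal partially complete $b$-singular flag $\mathcal{F}$ of the $\mathbb{F}$-vector space $V$ such that $\mathcal{V}=\mathrm{WH}_{b,\mathcal{F}}$.
   Context: A sesquilinear form $b$ on $V$ is linear in the second argument and satisfies $b(\alpha x+x',y)=\alpha^\star b(x,y)+b(x',y)$; it is Hermitian if $b(y,x)=b(x,y)^\star$ for all $x,y$; non-degenerate if $b(x,y)=0$ for all $x$ forces $y=0$. An $\mathbb{F}$-subspace $X$ is totally $b$-singular if $b(x,y)=0$ for all $x,y\in X$; the Witt index is the maximal $\mathbb{F}$-dimension of such a subspace. An $\mathbb{F}$-linear endomorphism $u$ of $V$ is $b$-Hermitian if $b(u(x),y)=b(x,u(y))$ for all $x,y$; $\mathcal{H}_b$ is the $\mathbb{K}$-linear space of these. A flag $(F_0,\dots,F_p)$ of $\mathbb{F}$-subspaces is partially complete if $\dim_{\mathbb{F}}F_i=i$ for all $i$, $b$-singular if $F_p$ is totally $b$-singular,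 and maximal if $p=\nu$. $\mathrm{WH}_{b,\mathcal{F}}$ is the set of nilpotent $u\in\mathcal{H}_b$ with $u(F_i)\subseteq F_i$ for all $i$. *)

(* Defs.v *)
(* V = 'rV[F]_n (an n-dim F-space, vectors as row vectors);
   F-linear endomorphisms are matrices u : 'M[F]_n acting by x |-> x *m u;
   F-subspaces of V are row spaces of matrices (mxalgebra), dim = \rank. *)
From HB Require Import structures.
From mathcomp Require Import all_boot all_order all_algebra.
Set Implicit Arguments. Unset Strict Implicit. Unset Printing Implicit Defensive.
Import GRing.Theory.
Local Open Scope ring_scope.

Section Defs.
Variable F : fieldType.
Variable conj : F -> F.
Variable n : nat.
Implicit Types (b : 'rV[F]_n -> 'rV[F]_n -> F).

(* conj (a ring morphism, see Statement) is an involution (order <= 2 field automorphism) that is not the identity *)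
Definition nontriv_involution :=
  (forall x, conj (conj x) = x) /\ (exists x, conj x != x).
End Defs.

Definition is_sesquilinear (F : fieldType) (conj : F -> F) (n : nat)
  (b : 'rV[F]_n -> 'rV[F]_n -> F) :=
  (forall a x x' y, b (a *: x + x') y = conj a * b x y + b x' y) /\
  (forall a x y y', b x (a *: y + y') = a * b x y + b x y').

Definition is_hermitian_form (F : fieldType) (conj : F -> F) (n : nat)
  (b : 'rV[F]_n -> 'rV[F]_n -> F) :=
  forall x y, b y x = conj (b x y).

Definition nondeg_sesq_form (F : fieldType) (n : nat) (b : 'rV[F]_n -> 'rV[F]_n -> F) :=
  forall y, (forall x, b x y = 0) -> y = 0.

Definition totally_singular (F : fieldType) (n m : nat)
  (b : 'rV[F]_n -> 'rV[F]_n -> F) (X : 'M[F]_(m, n)) :=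
  forall x y : 'rV[F]_n, (x <= X)%MS -> (y <= X)%MS -> b x y = 0.

Definition witt_index (F : fieldType) (n : nat)
  (b : 'rV[F]_n -> 'rV[F]_n -> F) (nu : nat) :=
  (exists X : 'M[F]_n, totally_singular b X /\ \rank X = nu) /\
  (forall X : 'M[F]_n, totally_singular b X -> (\rank X <= nu)%N).

Definition b_hermitian_endo (F : fieldType) (n : nat)
  (b : 'rV[F]_n -> 'rV[F]_n -> F) (u : 'M[F]_n) :=
  forall x y, b (x *m u) y = b x (y *m u).

Definition nilpotent_mx (F : fieldType) (n : nat) (u : 'M[F]_n) :=
  exists k : nat, u ^+ k = 0.

Definition K_subspace (F : fieldType) (conj : F -> F) (n : nat) (S : 'M[F]_n -> Prop) :=
  S 0 /\ (forall u v, S u -> S v -> S (u + v)) /\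
  (forall a u, conj a = a -> S u -> S (a *: u)).

Definition K_free (F : fieldType) (conj : F -> F) (n m : nat) (f : 'I_m -> 'M[F]_n) :=
  forall c : 'I_m -> F, (forall i, conj (c i) = c i) ->
    \sum_(i < m) c i *: f i = 0 -> forall i, c i = 0.

Definition K_dim (F : fieldType) (conj : F -> F) (n : nat) (S : 'M[F]_n -> Prop) (d : nat) :=
  (exists f : 'I_d -> 'M[F]_n, (forall i, S (f i)) /\ K_free conj f) /\
  (forall m (f : 'I_m -> 'M[F]_n), (forall i, S (f i)) -> K_free conj f -> (m <= d)%N).

Definition partially_complete_flag (F : fieldType) (n p : nat) (Fl : 'I_p.+1 -> 'M[F]_n) :=
  (forall i, \rank (Fl i) = i) /\
  (forall i j : 'I_p.+1, (i <= j)%N -> (Fl i <= Fl j)%MS).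

Definition WH (F : fieldType) (n p : nat) (b : 'rV[F]_n -> 'rV[F]_n -> F)
  (Fl : 'I_p.+1 -> 'M[F]_n) (u : 'M[F]_n) :=
  nilpotent_mx u /\ b_hermitian_endo b u /\ (forall i, (Fl i *m u <= Fl i)%MS).

Definition card_gt (F : fieldType) (k : nat) :=
  exists s : seq F, uniq s /\ size s = k.+1.

(* Main.v *)
Require Import Defs.
From HB Require Import structures.
From Stdlib Require Import Classical.
From mathcomp Require Import all_boot all_order all_algebra perm.
From mathcomp Require Import zify ring.

(** Let D be the space of endomorphisms stabilising a maximal singular flag and
    the orthogonals of its members. The second coefficient of the characteristic
    polynomial shows that tr(uv) = 0 on the nilpotent space S. A nilpotent
    Hermitian element of D strictly lowers the flag, hence is orthogonal to D
    for the trace form. Thus the span of S meets D in a subspace orthogonal to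
    S + D, and dim S <= n^2 - dim D = nu (2n - 2nu - 1). Hermitian families
    are free over the fixed field K if and only if they are free over F, so all
    dimensions can be taken over F.

    In the extremal case, a Hermitian endomorphism orthogonal to S and to D
    lies in S. If K has at least three elements, the third coefficient gives
    tr(u^2 v) = 0 on S; taking for D the stabiliser of a flag fixed by u shows
    that u^2 is in S. So S is closed under uv + vu, and by Jacobson's theorem
    S acts nilpotently on V. It follows that S stabilises a maximal singular
    flag, and extremality forces S = WH. *)

Set Implicit Arguments.
Unset Strict Implicit.
Unset Printing Implicit Defensive.
Import GRing.Theory.
Local Open Scope ring_scope.

(** * Traces of nilpotent matrices *)

Lemma prod_1_addZ (R : comNzRingType) (I : Type) (s : seq I) (a : I -> R)
    (y : R) :
  exists r, \prod_(i <- s) (1 + y * a i) =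
            1 + y * (\sum_(i <- s) a i) + y ^+ 2 * r.
Proof.
elim: s => [|i s [r IHs]]; first by exists 0; rewrite !big_nil; ring.
rewrite !big_cons IHs.
by exists (r + a i * (\sum_(j <- s) a j) + y * a i * r); ring.
Qed.

(** A non-identity permutation [s] moves both some [i] and [s i], so its term has two off-diagonal
    factors, each a multiple of [y]. Only the identity contributes below order 2. *)
Lemma det_1_addZ (R : comNzRingType) (n : nat) (M : 'M[R]_n) (y : R) :
  exists r, \det (1%:M + y *: M) = 1 + y * \tr M + y ^+ 2 * r.
Proof.
rewrite /determinant (bigD1 (1%g : {perm 'I_n})) //=.
have [r1 ->] : exists r1,
    (-1) ^+ (1%g : {perm 'I_n}) *
      \prod_i (1%:M + y *: M) i ((1%g : {perm 'I_n}) i) =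
    1 + y * \tr M + y ^+ 2 * r1.
  have [r1 def_r1] := prod_1_addZ (index_enum 'I_n) (fun i => M i i) y.
  exists r1; rewrite -def_r1 odd_perm1 expr0 mul1r.
  by apply: eq_bigr => i _; rewrite perm1 !mxE eqxx.
have [r2 ->] : exists r2,
    \sum_(s : {perm 'I_n} | s != 1%g)
      (-1) ^+ s * \prod_i (1%:M + y *: M) i (s i) = y ^+ 2 * r2.
  apply: (big_ind (fun x => exists r2, x = y ^+ 2 * r2)).
  - by exists 0; rewrite mulr0.
  - by move=> _ _ [a ->] [c ->]; exists (a + c); rewrite mulrDr.
  move=> s s_neq1.
  have /existsP[i si_neq] : [exists i, s i != i].
    apply: contraNT s_neq1; rewrite negb_exists => /forallP s_id.
    by apply/eqP/permP=> i; rewrite perm1; move/negbNE/eqP: (s_id i).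
  have ssi_neq : s (s i) != s i by rewrite (inj_eq perm_inj).
  rewrite (bigD1 i) //= (bigD1 (s i)) //= !mxE.
  rewrite eq_sym (negPf si_neq) eq_sym (negPf ssi_neq) !add0r.
  move: (\prod_(_ | _) _) ((-1) ^+ s) (M i _) (M (s i) _) => p e a c.
  by exists (e * a * c * p); ring.
by exists (r1 + r2); ring.
Qed.

Section NilpotentTraces.
Variables (F : fieldType) (n : nat).
Implicit Types u v : 'M[F]_n.

Local Notation "u %:PM" := (map_mx polyC u) (at level 2, format "u %:PM").
Local Notation resolvent u := ((1%:M : 'M[{poly F}]_n) - 'X *: u%:PM).

Lemma exprmxZ (R : comNzRingType) (a : R) (M : 'M[R]_n) k :
  (a *: M) ^+ k = a ^+ k *: M ^+ k.
Proof.
elim: k => [|k IHk]; first by rewrite !expr0 scale1r.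
by rewrite !exprS IHk -!mulmxE -scalemxAl -scalemxAr scalerA.
Qed.

(** The inverse is a finite geometric series. Its first two terms are kept explicit because they
    determine the coefficients extracted in [nilpotent_tr_mul]. *)
Lemma resolvent_inv u : nilpotent_mx u ->
  exists Q : 'M[{poly F}]_n,
    resolvent u *m (1%:M + 'X *: u%:PM + 'X^2 *: Q) = 1%:M.
Proof.
case=> k uk0.
exists (u%:PM ^+ 2 *m \sum_(i < k) ('X *: u%:PM) ^+ i).
set Y := 'X *: u%:PM.
have Yk0 : Y ^+ k = 0.
  have ->: Y ^+ k = 'X^k *: (u ^+ k)%:PM by rewrite exprmxZ rmorphXn.
  by rewrite uk0 map_mx0 scaler0.
have -> : 1%:M + Y + 'X^2 *: (u%:PM ^+ 2 *m \sum_(i < k) Y ^+ i) =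
          1%:M + Y + Y ^+ 2 * \sum_(i < k) Y ^+ i.
  by rewrite exprmxZ -mulmxE scalemxAl.
have Ysum : (1 - Y) * (\sum_(i < k) Y ^+ i) = 1.
  have := subrX1 Y k; rewrite Yk0 => /(congr1 -%R).
  by rewrite sub0r opprK -mulNr opprB.
have com : (1 - Y) * Y ^+ 2 = Y ^+ 2 * (1 - Y).
  by rewrite mulrBl mulrBr mul1r mulr1 -exprS -exprSr.
rewrite !mulmxE -[1%:M]/(1 : 'M_n) mulrDr [X in _ + X]mulrA com -mulrA Ysum.
by rewrite mulr1 mulrDr mulr1 mulrBl mul1r expr2 addrA addrNK addrNK.
Qed.

(** The determinant is a unit of F[X], hence a constant, and its constant coefficient is 1. *)
Lemma det_resolvent u : nilpotent_mx u -> \det (resolvent u) = 1.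
Proof.
case/resolvent_inv=> Q /(congr1 determinant); rewrite det_mulmx det1 => detM.
have : \det (resolvent u) \is a GRing.unit.
  by apply/unitrPr; exists (\det (1%:M + 'X *: u%:PM + 'X^2 *: Q)).
have [r def_det] := det_1_addZ (- u%:PM) 'X.
have {}def_det : \det (resolvent u) = 1 + 'X * (\tr (- u%:PM) + 'X * r).
  by rewrite -scalerN def_det; ring.
rewrite poly_unitE => /andP[/eqP sz1 _]; have detC := size1_polyC (eq_leq sz1).
have det0 : (\det (resolvent u))`_0 = 1.
  by rewrite def_det coefD coef1 coefXM /= addr0.
by rewrite detC det0.
Qed.

Lemma nilpotent_tr0 u : nilpotent_mx u -> \tr u = 0.
Proof.
move=> nil_u; have [r] := det_1_addZ (- u%:PM) 'X.
rewrite scalerN det_resolvent // => /(congr1 (fun p : {poly F} => p`_1)).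
rewrite -addrA coefD expr2 -mulrA -mulrDr coefXM coefD coefXM /= addr0 coef1.
rewrite add0r linearN coefN /=.
by rewrite trace_map_mx coefC /= => /eqP; rewrite eq_sym oppr_eq0 => /eqP.
Qed.

(* Compare coefficients of X^2 and X^3 in the determinant of
   (1 - Xu)(1 - Xv) = (1 - X(u+v)) (1 + X^2 (1 - X(u+v))^-1 uv),
   where every factor but the last has determinant 1. *)
Lemma nilpotent_tr_mul u v :
    nilpotent_mx u -> nilpotent_mx v -> nilpotent_mx (u + v) ->
  \tr (u *m v) = 0 /\ \tr ((u + v) *m u *m v) = 0.
Proof.
move=> nil_u nil_v nil_uv; have [Q invQ] := resolvent_inv nil_uv.
set R := 1%:M + _ + _ in invQ.
have fact : resolvent u *m resolvent v =
    resolvent (u + v) *m (1%:M + 'X^2 *: (R *m (u *m v)%:PM)).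
  rewrite mulmxDr mulmx1 -scalemxAr mulmxA invQ mul1mx map_mxD map_mxM.
  rewrite mulmxBl mul1mx mulmxBr mulmx1 -scalemxAl -scalemxAr scalerA.
  by rewrite -expr2 scalerDr !opprD !opprK !addrA [X in X + _]addrAC.
move/(congr1 determinant): fact.
rewrite !det_mulmx !det_resolvent // !mul1r.
(* With ['X^2] as the small parameter, the error term starts at X^4 and leaves the coefficients of
   X^2 and X^3 untouched. *)
have [r ->] := det_1_addZ (R *m (u *m v)%:PM) 'X^2.
move/eqP; rewrite -addrA addrC -subr_eq subrr => /eqP eq0.
have {}eq0 : 'X^2 * (\tr (R *m (u *m v)%:PM) + 'X^2 * r) = 0.
  by rewrite [LHS]mulrDr eq0; ring.
have trR : \tr (R *m (u *m v)%:PM) = (\tr (u *m v))%:P +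
    'X * (\tr ((u + v) *m u *m v))%:P + 'X^2 * \tr (Q *m (u *m v)%:PM).
  rewrite /R [X in \tr X = _]mulmxDl [X in \tr (X + _)]mulmxDl mul1mx.
  rewrite -!scalemxAl !mxtraceD !mxtraceZ.
  by rewrite -map_mxM !trace_map_mx mulmxA.
have {}eq0 : (\tr (u *m v))%:P + 'X * (\tr ((u + v) *m u *m v))%:P +
    'X^2 * (\tr (Q *m (u *m v)%:PM) + r) = 0.
  apply/eqP; move/eqP: eq0; rewrite mulf_eq0 expf_eq0 polyX_eq0 /= trR.
  by rewrite mulrDr addrA.
split.
  move/(congr1 (fun p : {poly F} => p`_0)): eq0.
  by rewrite -addrA expr2 -mulrA -mulrDr coefD coefXM coefC coef0 /= addr0.
move/(congr1 (fun p : {poly F} => p`_1)): eq0.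
rewrite coef0 -addrA expr2 -mulrA -mulrDr coefD coefXM coefD coefXM !coefC.
by rewrite /= addr0 add0r.
Qed.

End NilpotentTraces.

(** * Jacobson's theorem on nilpotent sets closed under uv + vu *)

Lemma row_free_col_mx (F : fieldType) (m k : nat) (v : 'rV[F]_m)
    (M : 'M[F]_(k, m)) :
  row_free M -> ~~ (v <= M)%MS -> row_free (col_mx v M).
Proof.
move=> freeM vM; rewrite -row_leq_rank -addsmxE -{1}(eqP freeM) add1n.
by apply: rank_ltmx; rewrite /ltmx addsmxSr /= addsmx_sub (negPf vM).
Qed.

Section NilpotentSets.
Variables (F : fieldType) (n : nat).
Implicit Types (A B : 'M[F]_n -> Prop) (u v w X W : 'M[F]_n) (x : 'rV[F]_n).

Fixpoint word A N w : Prop :=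
  if N is N'.+1 then exists u v, A u /\ word A N' v /\ w = u *m v else w = 1%:M.

Definition nilpotent_set A := exists N, forall w, word A N w -> w = 0.

Lemma word_sub A B : (forall u, A u -> B u) ->
  forall N w, word A N w -> word B N w.
Proof.
move=> AB; elim=> [|N IHN] w //= [u [v [Au [Av ->]]]].
by exists u, v; split; [apply: AB | split; [apply: IHN|]].
Qed.

Lemma nilpotent_set_sub A B :
  (forall u, A u -> B u) -> nilpotent_set B -> nilpotent_set A.
Proof. by move=> AB [N BN]; exists N => w /(word_sub AB); apply: BN. Qed.

Lemma nilpotent_set1 u : nilpotent_mx u -> nilpotent_set (fun v => v = u).
Proof.
case=> k uk0; exists k; rewrite -uk0.
elim: k {uk0} => [|k IHk] w /=; first by rewrite expr0 => ->.
by case=> _ [v [-> [/IHk -> ->]]]; rewrite exprS mulmxE.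
Qed.

(** Otherwise every vector of [W] outside [X] could be moved by [A] to another such vector, and
    arbitrarily long words would be nonzero. *)
Lemma nilpotent_set_step A X (W : 'rV[F]_n -> Prop) x : nilpotent_set A ->
    (forall u y, A u -> W y -> W (y *m u)) -> W x -> ~~ (x <= X)%MS ->
  exists y, [/\ W y, ~~ (y <= X)%MS & forall u, A u -> (y *m u <= X)%MS].
Proof.
move=> [N AN] stabW Wx x_notX; apply: NNPP => no_y.
have escape y : W y -> ~~ (y <= X)%MS -> exists2 u, A u & ~~ (y *m u <= X)%MS.
  move=> Wy yX; apply: NNPP => no_u; apply: no_y; exists y; split=> // u Au.
  by case: (boolP (_ <= _)%MS) => // yuX; case: no_u; exists u.
have long k y : W y -> ~~ (y <= X)%MS ->
    exists2 w, word A k w & ~~ (y *m w <= X)%MS.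
  elim: k y => [|k IHk] y Wy yX; first by exists 1%:M; rewrite ?mulmx1.
  have [u Au yuX] := escape y Wy yX.
  have [w Aw yuwX] := IHk (y *m u) (stabW u y Au Wy) yuX.
  by exists (u *m w); [exists u, w | rewrite mulmxA].
have [w /AN ->] := long N x Wx x_notX.
by rewrite mulmx0 sub0mx.
Qed.

(** Adjoining the vectors [x] one at a time gives a chain of subspaces, up to the whole space, each
    of which [A] maps into the preceding one. *)
Lemma step_nilpotent_set A :
    (forall X, (forall u, A u -> (X *m u <= X)%MS) -> ~~ row_full X ->
       exists2 x : 'rV[F]_n, ~~ (x <= X)%MS & forall u, A u -> (x *m u <= X)%MS) ->
  nilpotent_set A.
Proof.
move=> stepA.
have chain k : (k <= n)%N -> exists X N,
    [/\ (k <= \rank X)%N, forall u, A u -> (X *m u <= X)%MS &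
        forall w, word A N w -> X *m w = 0].
  elim: k => [|k IHk] k_le_n.
    exists 0, 0; split=> // [u _|w _]; first by rewrite mul0mx sub0mx.
    by rewrite mul0mx.
  have [X [N [kX stabX XN]]] := IHk (ltnW k_le_n).
  have [|Xk] := ltnP k (\rank X); first by exists X, N.
  have [|x xX xAX] := stepA X stabX.
    by rewrite -col_leq_rank -ltnNge (leq_ltn_trans Xk).
  have addX u : A u -> ((X + x)%MS *m u <= X)%MS.
    move=> Au; rewrite (eqmxMr u (addsmxE _ _)) mul_col_mx col_mx_sub.
    by rewrite stabX ?xAX.
  exists (X + x)%MS, N.+1; split=> [|u Au|w [u [v [Au [Av ->]]]]].
  - apply: leq_ltn_trans kX _; apply: rank_ltmx; rewrite /ltmx addsmxSl.
    by apply: contra xX; apply: submx_trans; exact: addsmxSr.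
  - exact: submx_trans (addX u Au) (addsmxSl _ _).
  - apply/eqP; rewrite mulmxA -submx0.
    by rewrite (submx_trans (submxMr v (addX u Au))) // XN ?sub0mx.
have [X [N [nX _ XN]]] := chain n (leqnn n).
exists N => w /XN Xw0; have /row_fullP[Y YX] : row_full X by rewrite -col_leq_rank.
by rewrite -[w]mul1mx -YX -mulmxA Xw0 mulmx0.
Qed.

Definition jordan_closed A :=
  forall u v, A u -> A v -> A (u *m v + v *m u).

(** * The filtration of the space attached to a nilpotent set *)

Section Filtration.
Variable B : 'M[F]_n -> Prop.

(** The layers increase from 0 to the whole space when [B] is nilpotent. The maps in [lowers] form a
    linear space that contains [B] and is still a nilpotent set; it stands in for the associative
    algebra generated by [B]. *)
Definition layer i x := forall w, word B i w -> x *m w = 0.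
Definition lowers u := forall i x, layer i.+1 x -> layer i (x *m u).

Lemma layerD i x (y : 'rV[F]_n) : layer i x -> layer i y -> layer i (x + y).
Proof. by move=> lx ly w Bw; rewrite mulmxDl lx ?ly ?addr0. Qed.

Lemma layerZ i a x : layer i x -> layer i (a *: x).
Proof. by move=> lx w Bw; rewrite -scalemxAl lx ?scaler0. Qed.

Lemma layer_0 i : layer i 0.
Proof. by move=> w _; rewrite mul0mx. Qed.

Lemma layer0 x : layer 0 x -> x = 0.
Proof. by move=> /(_ 1%:M erefl); rewrite mulmx1. Qed.

Lemma layerS i x : layer i x -> layer i.+1 x.
Proof.
elim: i x => [|i IHi] x lx; first by rewrite (layer0 lx); apply: layer_0.
move=> w [u [v [Bu [Bv ->]]]]; rewrite mulmxA; apply: IHi => // w' Bw'.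
by rewrite -mulmxA lx //; exists u, w'.
Qed.

Lemma layer_le i j x : (i <= j)%N -> layer i x -> layer j x.
Proof.
by move=> /subnK <-; elim: (j - i)%N => // k IHk /IHk; apply: layerS.
Qed.

Lemma sub_lowers u : B u -> lowers u.
Proof. by move=> Bu i x lx w Bw; rewrite -mulmxA lx //; exists u, w. Qed.

Lemma lowersD u v : lowers u -> lowers v -> lowers (u + v).
Proof. by move=> lu lv i x lx; rewrite mulmxDr; apply: layerD; auto. Qed.

Lemma lowersZ a u : lowers u -> lowers (a *: u).
Proof. by move=> lu i x lx; rewrite -scalemxAr; apply: layerZ; auto. Qed.

Lemma lowers_sum I (r : seq I) (f : I -> 'M[F]_n) :
  (forall i, lowers (f i)) -> lowers (\sum_(i <- r) f i).
Proof.
move=> lf; apply: big_ind => //; last exact: lowersD.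
by move=> i x _; rewrite mulmx0; apply: layer_0.
Qed.

Hypothesis nilB : nilpotent_set B.

Lemma lowers_nilpotent : nilpotent_set lowers.
Proof.
have [N BN] := nilB; exists N => w word_w.
have low k w' x : layer k x -> word lowers k w' -> x *m w' = 0.
  elim: k w' x => [|k IHk] w' x lx; first by rewrite (layer0 lx) mul0mx.
  by case=> u [v [lu [lv ->]]]; rewrite mulmxA; apply: IHk => //; apply: lu.
apply/row_matrixP=> i; rewrite row0 rowE.
by apply: (low N) => // w' /BN ->; rewrite mulmx0.
Qed.

(* If [u *m x + x *m u] kept leaving [lowers], iterating would nevertheless
   lower the degree of [u] with respect to the layers at each step. *)
Lemma exists_normalizing A : jordan_closed A -> forall u, A u -> ~ lowers u ->
  exists v, [/\ A v, ~ lowers v &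
    forall w, A w -> lowers w -> lowers (v *m w + w *m v)].
Proof.
move=> jA u Au u_notE; apply: NNPP => no_y; have [N BN] := nilB.
have layerN i x : layer (i + N) x.
  by apply: (@layer_le N); [exact: leq_addl | move=> w /BN ->; rewrite mulmx0].
(* [deg k y] says that [y] raises the layer index by at most N - k, written without subtraction. It
   is vacuous for k = 0 and gives [lowers y] for k = N + 1. *)
pose deg k y := forall i j x, (i + N = j + k)%N -> layer i x -> layer j (x *m y).
have iter k : exists y, [/\ A y, ~ lowers y & deg k y].
  elim: k => [|k [y [Ay yE degy]]].
    exists u; split=> // i j x; rewrite addn0 => <- _; exact: layerN.
  have [z [Az zE yzE]] : exists z, [/\ A z, lowers z & ~ lowers (y *m z + z *m y)].
    apply: NNPP => no_z; apply: no_y; exists y; split=> // z Az zE.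
    by apply: NNPP => yzE; apply: no_z; exists z.
  exists (y *m z + z *m y); split=> //; first exact: jA.
  move=> i j x ij lx; rewrite mulmxDr; apply: layerD; rewrite mulmxA.
    by apply/zE/(degy i) => //; rewrite ij addSnnS.
  (* [lowers] says nothing about layer 0, which is the zero space. *)
  case: i ij lx => [|i] ij lx.
    by rewrite (layer0 lx) !mul0mx; apply: layer_0.
  by apply: (degy i); [lia | apply: zE].
have [y [_ yE degy]] := iter N.+1; apply: yE => i x lx.
by apply: (degy i.+1 i); [lia|].
Qed.

End Filtration.

(** Choose [x] outside a stable [X] with [x A] inside [X]. As yu = (yu + uy) - uy, induction shows
    that [A] also maps each x y^i into [X]. The last x y^i outside [X] is then sent into [X] by [y]
    too. *)
Lemma nilpotent_set_adjoin A y : nilpotent_set A -> nilpotent_mx y ->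
    (forall u, A u -> A (y *m u + u *m y)) ->
  nilpotent_set (fun u => A u \/ u = y).
Proof.
move=> nilA [k yk0] Ay; apply: step_nilpotent_set => X stabX X_notT.
have /row_subPn[r r_notX] : ~~ (1%:M <= X)%MS by rewrite sub1mx.
have [//|x [_ xX xAX]] :=
  @nilpotent_set_step A X (fun=> True) _ nilA _ I r_notX.
have yX : (X *m y <= X)%MS by apply: stabX; right.
have xyA i u : A u -> (x *m y ^+ i *m u <= X)%MS.
  elim: i u => [|i IHi] u Au; first by rewrite expr0 mulmx1 xAX.
  rewrite exprSr -mulmxE !mulmxA -[_ *m y *m u]mulmxA.
  have -> : y *m u = (y *m u + u *m y) - u *m y by rewrite addrK.
  rewrite mulmxBr addmx_sub ?IHi //; first exact: Ay.
  by rewrite eqmx_opp mulmxA (submx_trans (submxMr y (IHi u Au))).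
have /ex_minnP[m xym min_m] : exists i, (x *m y ^+ i <= X)%MS.
  by exists k; rewrite yk0 mulmx0 sub0mx.
case: m xym min_m => [|m] xym min_m.
  by move: xym; rewrite expr0 mulmx1 (negPf xX).
exists (x *m y ^+ m).
  by apply/negP=> /min_m; rewrite ltnn.
move=> u [/xyA//|->].
by rewrite -mulmxA mulmxE -exprSr.
Qed.

(** If [A] is not nilpotent, a free nilpotent family in [A] can always be enlarged: [A] is not
    contained in the space [E] lowering its layers, and [exists_normalizing] yields [y] in [A]
    outside [E] that can be adjoined to the part of [A] inside [E]. As [E] is linear and contains
    the family, freeness persists, which fails beyond n * n members. *)
Theorem jordan_closed_nilpotent A : jordan_closed A ->
  (forall u, A u -> nilpotent_mx u) -> nilpotent_set A.
Proof.
move=> jA nilA; apply: NNPP => A_not_nil.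
pose rows k (M : 'M[F]_(k, n * n)) u := exists i, u = vec_mx (row i M).
have grow k : exists M : 'M[F]_(k, n * n),
    [/\ row_free M, forall u, rows k M u -> A u & nilpotent_set (rows k M)].
  elim: k => [|k [M [freeM MA nilM]]].
    exists 0; split=> [|u [[]]|] //; first by rewrite /row_free mxrank0.
    by exists 1%N => w [u [v [[[]]]]].
  rewrite -[k.+1]add1n; pose E := lowers (rows k M).
  have [AE|] := classic (forall u, A u -> E u).
    by case: A_not_nil; apply: nilpotent_set_sub AE (lowers_nilpotent nilM).
  case/not_all_ex_not=> s /(imply_to_and (A s)) [As s_notE].
  have [y [Ay yE yAE]] := exists_normalizing nilM jA As s_notE.
  exists (col_mx (mxvec y) M); split.
  - apply: row_free_col_mx => //; apply/negP=> /submxP[c def_y]; apply: yE.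
    rewrite -[y]mxvecK def_y mulmx_sum_row linear_sum.
    apply: lowers_sum => i; rewrite linearZ; apply: lowersZ.
    by apply: sub_lowers; exists i.
  - move=> _ [i ->]; case: (split_ordP i) => j ->.
      by rewrite rowKu row_id mxvecK.
    by rewrite rowKd; apply: MA; exists j.
  - have : nilpotent_set (fun u => (A u /\ E u) \/ u = y).
      apply: nilpotent_set_adjoin => [||u [Au Eu]]; last 1 first.
      + by split; [apply: jA | apply: yAE].
      + by apply: nilpotent_set_sub (lowers_nilpotent nilM) => u [].
      + exact: nilA.
    apply: nilpotent_set_sub => _ [i ->].
    case: (split_ordP i) => j ->.
      by right; rewrite rowKu row_id mxvecK.
    left; rewrite rowKd; split; first by apply: MA; exists j.
    by apply: sub_lowers; exists j.
have [M [freeM _ _]] := grow (n * n).+1.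
by have := rank_leq_col M; rewrite (eqP freeM) ltnn.
Qed.

End NilpotentSets.

(** * Codimension of flag stabilisers *)

Lemma stable_rowsP (F : fieldType) (m n p : nat) (W : 'M[F]_(m, n))
    (u : 'M[F]_n) (X : 'M[F]_(p, n)) :
  reflect (forall x : 'rV_n, (x <= W)%MS -> (x *m u <= X)%MS) (W *m u <= X)%MS.
Proof.
apply: (iffP idP) => [WuX x xW | WuX].
  exact: submx_trans (submxMr u xW) WuX.
by apply/row_subP=> i; rewrite row_mul WuX ?row_sub.
Qed.

Lemma submx_adjoin (F : fieldType) (n : nat) (X Y : 'M[F]_n) (x : 'rV[F]_n) :
    (X <= Y)%MS -> \rank Y = (\rank X).+1 -> (x <= Y)%MS -> ~~ (x <= X)%MS ->
  (Y <= X + x)%MS.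
Proof.
move=> XY rkY xY xX; have XxY : (X + x <= Y)%MS by rewrite addsmx_sub XY xY.
rewrite -(geq_leqif (mxrank_leqif_sup XxY)) rkY; apply: rank_ltmx.
by rewrite /ltmx addsmxSl /= addsmx_sub (negPf xX) andbF.
Qed.

(** [D'] is the kernel of the map from [D] to Y/Z induced by [g]. *)
Lemma codim_preimage (F : fieldType) (m N p : nat) (D : 'M[F]_(m, N))
    (g : 'M[F]_(N, p)) (Y Z : 'M[F]_p) :
    (D *m g <= Y)%MS -> (Z <= Y)%MS ->
  exists D' : 'M[F]_N, [/\ (D' <= D)%MS,
    (\rank D + \rank Z <= \rank D' + \rank Y)%N &
    forall v : 'rV_N, (v <= D')%MS -> (v *m g <= Z)%MS].
Proof.
move=> DgY ZY; pose C := cokermx Z.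
exists (D :&: kermx (g *m C))%MS; split; first exact: capmxSl.
  have := mxrank_mul_ker D (g *m C); have := mxrank_mul_ker Y C.
  have kerC : (Z <= Y :&: kermx C)%MS.
    by rewrite sub_capmx ZY; apply/sub_kermxP; rewrite mulmx_coker.
  have := mxrankS kerC; have := mxrankS (submxMr C DgY).
  rewrite -mulmxA; lia.
move=> v; rewrite sub_capmx => /andP[_ /sub_kermxP vgC].
by rewrite submxE -mulmxA vgC.
Qed.

(** Once [H p] is stable, stability of [H p.+1] concerns a single further vector, whose image in [Y]
    has to fall in [H p.+1]; this costs at most [\rank Y - p.+1] linear conditions. The map [T]
    allows the lemma to be applied to transposes as well. *)
Lemma codim_flag_stabilizer (F : fieldType) (n p : nat) (m : nat)
    (D : 'M[F]_(m, n * n)) (T : 'M[F]_(n * n)) (H : nat -> 'M[F]_n)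
    (Y : 'M[F]_n) :
    (forall i, (i <= p)%N -> \rank (H i) = i) ->
    (forall i, (i < p)%N -> (H i <= H i.+1)%MS) ->
    (forall i, (i <= p)%N -> (H i <= Y)%MS) ->
    (forall i v, (i <= p)%N -> (v <= D)%MS -> (H i *m vec_mx (v *m T) <= Y)%MS) ->
  exists D' : 'M[F]_(n * n), [/\ (D' <= D)%MS,
    (\rank D <= \rank D' + \sum_(i < p) (\rank Y - i.+1))%N &
    forall i v, (i <= p)%N -> (v <= D')%MS ->
      (H i *m vec_mx (v *m T) <= H i)%MS].
Proof.
move=> rkH; elim: p rkH => [|p IHp] rkH HS HY DY.
  exists (<<D>>)%MS; split; first by rewrite genmxE.
    by rewrite big_ord0 addn0 genmxE.
  move=> i v; rewrite leqn0 => /eqP -> _.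
  by have /eqP := rkH 0 isT; rewrite mxrank_eq0 => /eqP ->; rewrite mul0mx.
have [||||D1 [D1D rkD1 D1H]] := IHp.
- by move=> i ip; apply/rkH/leqW.
- by move=> i ip; apply/HS/leqW.
- by move=> i ip; apply/HY/leqW.
- by move=> i v ip; apply/DY/leqW.
have Hpp : (H p <= H p.+1)%MS by apply: HS.
have [rkp rkp1] : \rank (H p) = p /\ \rank (H p.+1) = p.+1.
  by split; apply: rkH.
have /row_subPn[r rH] : ~~ (H p.+1 <= H p)%MS.
  by apply/negP=> /mxrankS; rewrite rkp rkp1 ltnn.
set x := row r (H p.+1) in rH.
have xH : (x <= H p.+1)%MS by apply: row_sub.
have Hx : (H p.+1 <= H p + x)%MS by apply: submx_adjoin; rewrite ?rkp.
pose g := T *m lin_mul_row x.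
have gE v : v *m g = x *m vec_mx (v *m T).
  by rewrite mulmxA -[v *m T in LHS]vec_mxK mul_vec_lin_row.
have [||D' [D'D rkD' D'g]] := @codim_preimage _ _ _ _ D1 g Y (H p.+1).
- apply/row_subP=> i; rewrite row_mul gE.
  apply: submx_trans (DY p.+1 (row i D1) _ _) => //; first exact: submxMr.
  exact: submx_trans (row_sub _ _) D1D.
- exact: HY.
exists D'; split; first exact: submx_trans D'D D1D.
  rewrite big_ord_recr /=; move: rkD1 rkD' (mxrankS (HY p.+1 (leqnn _))).
  have arith (a c d y e : nat) : (a <= c + e)%N -> (c + p.+1 <= d + y)%N ->
    (p < y)%N -> (a <= d + (e + (y - p.+1)))%N by lia.
  rewrite rkp1; exact: arith.
move=> i v; rewrite leq_eqVlt => /orP[/eqP -> vD|ip vD]; last first.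
  by apply: D1H => //; apply: submx_trans D'D.
apply: submx_trans (submxMr _ Hx) _.
rewrite (eqmxMr _ (addsmxE _ _)) mul_col_mx col_mx_sub -gE D'g // andbT.
by apply: submx_trans Hpp; apply: D1H => //; apply: submx_trans D'D.
Qed.

Lemma sum_codim (p m : nat) : (p <= m)%N ->
  (2 * (\sum_(i < p) (m - i.+1)) + p * p.+1 = 2 * m * p)%N.
Proof.
elim: p => [|p IHp] pm; first by rewrite big_ord0 !muln0.
rewrite big_ord_recr /=; have := IHp (ltnW pm); rewrite -{2}(subnK pm).
have arith (s k : nat) : (2 * s + p * p.+1 = 2 * (k + p.+1) * p ->
  2 * (s + k) + p.+1 * p.+2 = 2 * (k + p.+1) * p.+1)%N by nia.
by move/(arith _ (m - p.+1)%N); rewrite subnK.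
Qed.

(** [s1] counts the conditions for stabilising the flag inside dimension n, [s2] those for its
    orthogonals inside dimension n - nu. *)
Lemma sum_codim2 (n nu s1 s2 : nat) : (2 * nu <= n)%N ->
    (2 * s1 + nu * nu.+1 = 2 * n * nu)%N ->
    (2 * s2 + nu * nu.+1 = 2 * (n - nu) * nu)%N ->
  (s1 + s2 = nu * (2 * n - 2 * nu - 1))%N.
Proof.
move=> /subnK; move: (n - 2 * nu)%N => r <-.
case: nu => [|k]; first by lia.
have -> : (r + 2 * k.+1 - k.+1 = r + k.+1)%N by lia.
have -> : (2 * (r + 2 * k.+1) - 2 * k.+1 - 1 = 2 * r + 2 * k + 1)%N by lia.
lia.
Qed.

Lemma mxvec_tr (F : fieldType) (n : nat) (u v : 'M[F]_n) :
  (mxvec u *m (mxvec v^T)^T) 0 0 = \tr (u *m v).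
Proof.
rewrite mxE (reindex _ (curry_mxvec_bij n n)) /= /mxtrace.
under [RHS]eq_bigr do rewrite mxE.
rewrite pair_bigA /=; apply: eq_bigr => -[i j] _ /=.
by rewrite mxE !mxvecE mxE.
Qed.

(** * Hermitian forms and singular flags *)

Section HermitianForm.
Variables (F : fieldType) (conj : {rmorphism F -> F}) (n : nat).
Variable b : 'rV[F]_n -> 'rV[F]_n -> F.
Hypothesis sesq : is_sesquilinear conj b.
Hypothesis herm : is_hermitian_form conj b.
Hypothesis nondeg : nondeg_sesq_form b.
Implicit Types (X Y : 'M[F]_n) (x y z : 'rV[F]_n).

Local Notation "A ^s" := (map_mx conj A) (at level 2, format "A ^s").
Local Notation hermitian := (b_hermitian_endo b).

Lemma hformDl x x' y : b (x + x') y = b x y + b x' y.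
Proof. by rewrite -[x]scale1r sesq.1 rmorph1 mul1r !scale1r. Qed.

Lemma hformDr x y y' : b x (y + y') = b x y + b x y'.
Proof. by rewrite -[y]scale1r sesq.2 mul1r !scale1r. Qed.

Lemma hform0l y : b 0 y = 0.
Proof. by have /eqP := hformDl 0 0 y; rewrite addr0 -subr_eq subrr eq_sym => /eqP. Qed.

Lemma hform0r x : b x 0 = 0.
Proof. by rewrite herm hform0l rmorph0. Qed.

Lemma hformZl a x y : b (a *: x) y = conj a * b x y.
Proof. by rewrite -[a *: x]addr0 sesq.1 hform0l addr0. Qed.

Lemma hformZr a x y : b x (a *: y) = a * b x y.
Proof. by rewrite -[a *: y]addr0 sesq.2 hform0r addr0. Qed.

Lemma hform_eq0C x y : b x y = 0 -> b y x = 0.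
Proof. by move=> xy0; rewrite herm xy0 rmorph0. Qed.

Definition gram : 'M[F]_n := \matrix_(i, j) b (delta_mx 0 i) (delta_mx 0 j).

Lemma hformE x y : b x y = (x^s *m gram *m y^T) 0 0.
Proof.
have suml I (r : seq I) c (f : I -> 'rV[F]_n) w :
    b (\sum_(i <- r) c i *: f i) w = \sum_(i <- r) conj (c i) * b (f i) w.
  elim: r => [|i r IHr]; first by rewrite !big_nil hform0l.
  by rewrite !big_cons sesq.1 IHr.
have sumr I (r : seq I) c (f : I -> 'rV[F]_n) w :
    b w (\sum_(i <- r) c i *: f i) = \sum_(i <- r) c i * b w (f i).
  elim: r => [|i r IHr]; first by rewrite !big_nil hform0r.
  by rewrite !big_cons sesq.2 IHr.
rewrite {1}(row_sum_delta y) sumr mxE; apply: eq_bigr => j _.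
rewrite mulrC [y^T _ _]mxE; congr (_ * _).
rewrite {1}(row_sum_delta x) suml mxE; apply: eq_bigr => i _.
by rewrite !mxE.
Qed.

Lemma gram_unit : gram \in unitmx.
Proof.
rewrite -unitmx_tr -row_free_unit -kermx_eq0; apply/eqP/row_matrixP=> i.
rewrite row0; apply: nondeg => x; rewrite hformE -mulmxA.
have -> : gram *m (row i (kermx gram^T))^T = 0.
  by rewrite -{1}[gram]trmxK -trmx_mul -row_mul mulmx_ker row0 trmx0.
by rewrite mulmx0 mxE.
Qed.

(** The rows are the coordinates of the linear forms [b x] for the rows [x] of [X], so that the
    orthogonal becomes an ordinary kernel. *)
Definition dual_rows m (X : 'M[F]_(m, n)) := X^s *m gram.
Definition perp m (X : 'M[F]_(m, n)) : 'M[F]_n := kermx (dual_rows X)^T.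

Lemma rank_dual_rows m (X : 'M[F]_(m, n)) : \rank (dual_rows X) = \rank X.
Proof. by rewrite mxrankMfree ?mxrank_map // row_free_unit gram_unit. Qed.

Lemma dual_rowsS m p (X : 'M[F]_(m, n)) (Y : 'M[F]_(p, n)) :
  (X <= Y)%MS -> (dual_rows X <= dual_rows Y)%MS.
Proof. by move=> XY; rewrite submxMr // map_submx. Qed.

Lemma rank_perp m (X : 'M[F]_(m, n)) : \rank (perp X) = (n - \rank X)%N.
Proof. by rewrite mxrank_ker mxrank_tr rank_dual_rows. Qed.

Lemma perpP m (X : 'M[F]_(m, n)) y :
  reflect (forall x, (x <= X)%MS -> b x y = 0) (y <= perp X)%MS.
Proof.
apply: (iffP sub_kermxP) => [yX0 _ /submxP[c ->] | Xy].
  rewrite hformE map_mxM -!mulmxA.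
  have -> : X^s *m (gram *m y^T) = (y *m (dual_rows X)^T)^T.
    by rewrite trmx_mul trmxK -mulmxA.
  by rewrite yX0 trmx0 mulmx0 mxE.
apply/rowP=> i; rewrite [RHS]mxE -(Xy (row i X) (row_sub _ _)) hformE.
have -> : (row i X)^s *m gram = row i (dual_rows X) by rewrite map_row row_mul.
rewrite mxE [RHS]mxE; apply: eq_bigr => j _; rewrite mulrC.
by rewrite [_^T j i]mxE [row i _ _ _]mxE [y^T _ _]mxE.
Qed.

Lemma perp_perp_sub m (X : 'M[F]_(m, n)) : (perp (perp X) <= X)%MS.
Proof.
have XX : (X <= perp (perp X))%MS.
  apply/row_subP=> i; apply/perpP=> x /perpP/(_ _ (row_sub i X)).
  exact: hform_eq0C.
rewrite -(geq_leqif (mxrank_leqif_sup XX)) !rank_perp.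
by rewrite subKn // rank_leq_col.
Qed.

Lemma singular_sub_perp X : totally_singular b X -> (X <= perp X)%MS.
Proof.
move=> singX; apply/row_subP=> i; apply/perpP=> x xX.
by apply: singX => //; apply: row_sub.
Qed.

Lemma singular_adjoin X x : totally_singular b X -> (x <= perp X)%MS ->
  b x x = 0 -> totally_singular b (X + x)%MS.
Proof.
move=> singX /perpP xX xx y z /sub_addsmxP[[u1 v1] /= ->].
case/sub_addsmxP=> -[u2 v2] /= ->.
rewrite [v1]mx11_scalar [v2]mx11_scalar !mul_scalar_mx.
rewrite !hformDl !hformDr !hformZl !hformZr xx !xX ?submxMl //.
rewrite (hform_eq0C (xX _ _)) ?submxMl // singX ?submxMl //.
by rewrite !(mulr0, addr0).
Qed.

Lemma hermitian_perp_stable X u : hermitian u -> (X *m u <= X)%MS ->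
  (perp X *m u <= perp X)%MS.
Proof.
move=> herm_u /stable_rowsP Xu; apply/stable_rowsP=> y /perpP yX.
by apply/perpP=> x xX; rewrite -herm_u yX ?Xu.
Qed.

(* A vector [x = y u] outside [X] that [A] maps into [X] is isotropic, since
   [b x x = b y (x u)] with [y] in [perp X] and [x u] in [X]. *)
Lemma isotropic_step (A : 'M[F]_n -> Prop) X y u : nilpotent_set A ->
    (forall v, A v -> hermitian v) -> (forall v, A v -> (X *m v <= X)%MS) ->
    (y <= perp X)%MS -> A u -> ~~ (y *m u <= X)%MS ->
  exists x, [/\ (x <= perp X)%MS, ~~ (x <= X)%MS, b x x = 0 &
                forall v, A v -> (x *m v <= X)%MS].
Proof.
move=> nilA hermA stabX yX Au yuX.
(* Searching among images only, instead of all of [perp X], guarantees that the vector found has the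
   form z v and is therefore isotropic. *)
pose W x := exists z v, [/\ (z <= perp X)%MS, A v & x = z *m v].
have stabP z v : A v -> (z <= perp X)%MS -> (z *m v <= perp X)%MS.
  move=> Av; move: z; apply/stable_rowsP.
  by apply: hermitian_perp_stable; [apply: hermA | apply: stabX].
have [||x [[z [v [zX Av def_x]]] xX xA]] := @nilpotent_set_step _ _ A X W _ nilA _ _ yuX.
- by move=> v x Av [z [w [zX Aw ->]]]; exists (z *m w), v; split=> //; apply: stabP.
- by exists y, u.
exists x; split=> //; first by rewrite def_x stabP.
rewrite {1}def_x hermA //; apply: hform_eq0C.
by move/perpP: zX; apply; apply: xA.
Qed.

(** * Maximal singular flags and their stabilisers *)

Section WittIndex.
Variable nu : nat.
Hypothesis witt : witt_index b nu.

Lemma witt_leq_half : (2 * nu <= n)%N.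
Proof.
have [[X [singX rkX]] _] := witt.
have := mxrankS (singular_sub_perp singX); rewrite rank_perp rkX.
by have := rank_leq_col X; rewrite rkX; lia.
Qed.

(** Let [Y] be singular of rank [nu]. The pairing of [X] with [Y] has rank nu - dim(Y ∩ X^⊥) and
    also dim X - dim(X ∩ Y^⊥), where X ∩ Y lies in X ∩ Y^⊥. If Y ∩ X^⊥ were inside [X], this would
    give nu <= dim X. *)
Lemma exists_isotropic_outside X : totally_singular b X ->
    (\rank X < nu)%N ->
  exists z, [/\ (z <= perp X)%MS, ~~ (z <= X)%MS & b z z = 0].
Proof.
move=> singX rkX; have [[Y [singY rkY]] _] := witt.
suff /row_subPn[i ziX] : ~~ (Y :&: perp X <= X)%MS.
  have := row_sub i (Y :&: perp X)%MS; rewrite sub_capmx => /andP[ziY ziP].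
  by exists (row i (Y :&: perp X)%MS); split=> //; apply: singY.
apply/negP=> capX.
have capXY : (Y :&: perp X <= X :&: Y)%MS by rewrite sub_capmx capX capmxSl.
have kerXY : ((X :&: Y)%MS^s <= X^s :&: kermx (gram *m Y^T))%MS.
  rewrite sub_capmx map_submx capmxSl /=; apply/sub_kermxP.
  have XYY : (Y <= perp (X :&: Y)%MS)%MS.
    apply/row_subP=> i; apply/perpP=> x; rewrite sub_capmx => /andP[_ xY].
    by apply: singY => //; apply: row_sub.
  move/sub_kermxP: XYY => /(congr1 trmx).
  by rewrite trmx_mul trmxK trmx0 mulmxA.
have rkYX : \rank (Y *m (dual_rows X)^T) = \rank (X^s *m (gram *m Y^T)).
  by rewrite -mxrank_tr trmx_mul trmxK mulmxA.
have := mxrank_mul_ker Y (dual_rows X)^T.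
have := mxrank_mul_ker X^s (gram *m Y^T).
move: (mxrankS capXY) (mxrankS kerXY); rewrite rkYX !mxrank_map rkY.
rewrite -/(perp X).
move: (\rank (Y :&: perp X)%MS) (\rank (X :&: Y)%MS) (\rank X) rkX => c d e.
by move: (\rank (_ *m _)) (\rank (_ :&: _)%MS); lia.
Qed.

(** Indexing by [nat], with no condition beyond [p], makes it easy to extend a flag by one step. *)
Definition singular_flag p (G : nat -> 'M[F]_n) :=
  [/\ forall i, (i <= p)%N -> \rank (G i) = i,
      forall i, (i < p)%N -> (G i <= G i.+1)%MS &
      totally_singular b (G p)].

Lemma singular_flag_leq p G : singular_flag p G ->
  forall i j, (i <= j <= p)%N -> (G i <= G j)%MS.
Proof.
case=> _ GS _ i j /andP[/subnK <-].
elim: (j - i)%N => [|k IHk] // kp.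
by rewrite addSn (submx_trans (IHk (ltnW kp))) // GS.
Qed.

(** The flag is extended one isotropic vector at a time. If [A] maps [perp (G p)] into [G p], any
    isotropic vector of [perp (G p)] outside [G p] will do; otherwise [isotropic_step] supplies
    one. *)
Lemma exists_stable_flag (A : 'M[F]_n -> Prop) : nilpotent_set A ->
    (forall u, A u -> hermitian u) ->
  exists2 G, singular_flag nu G &
    forall u i, A u -> (i <= nu)%N -> (G i *m u <= G i)%MS.
Proof.
move=> nilA hermA.
suff /(_ nu (leqnn nu)) : forall p, (p <= nu)%N -> exists2 G, singular_flag p G &
    forall u i, A u -> (i <= p)%N -> (G i *m u <= G i)%MS by [].
elim=> [|p IHp] p_le_nu.
  exists (fun=> 0) => [|u i _ _]; last by rewrite mul0mx sub0mx.
  split=> // [i|x y]; first by rewrite leqn0 => /eqP ->; rewrite mxrank0.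
  by rewrite submx0 => /eqP ->; rewrite hform0l.
have [G flagG stabG] := IHp (ltnW p_le_nu); have [rkG GS singG] := flagG.
have [x [xP xX xx xA]] : exists x,
    [/\ (x <= perp (G p))%MS, ~~ (x <= G p)%MS, b x x = 0 &
        forall u, A u -> (x *m u <= G p)%MS].
  have [AX|] := classic (forall u y, A u -> (y <= perp (G p))%MS ->
                           (y *m u <= G p)%MS).
    have [|z [zP zX zz]] := exists_isotropic_outside singG.
      by rewrite rkG.
    by exists z; split=> // u Au; apply: AX.
  move=> not_AX; have [u [y [Au yP yuX]]] : exists u y,
      [/\ A u, (y <= perp (G p))%MS & ~~ (y *m u <= G p)%MS].
    apply: NNPP => no_uy; apply: not_AX => u y Au yP.
    by case: (boolP (_ <= _)%MS) => // yuX; case: no_uy; exists u, y.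
  by apply: (isotropic_step nilA hermA _ yP Au yuX) => v Av; apply: stabG.
have ltX : (G p < G p + x)%MS.
  by rewrite /ltmx addsmxSl /= addsmx_sub (negPf xX) andbF.
exists (fun i => if (i <= p)%N then G i else (G p + x)%MS) => [|u i Au]; last first.
  rewrite leq_eqVlt => /orP[/eqP ->|]; last by rewrite ltnS => ip; rewrite ip stabG.
  rewrite ltnn; apply: submx_trans (addsmxSl _ _).
  by rewrite (eqmxMr _ (addsmxE _ _)) mul_col_mx col_mx_sub stabG ?xA.
split=> [i|i|].
- rewrite leq_eqVlt => /orP[/eqP ->|]; last by rewrite ltnS => ip; rewrite ip rkG.
  rewrite ltnn; apply/eqP; rewrite eqn_leq.
  rewrite -{3}(rkG p (leqnn p)) rank_ltmx // andbT.
  apply: leq_trans (mxrank_adds_leqif _ _).1 _.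
  by rewrite rkG //; have := rank_leq_row x; lia.
- rewrite ltnS => ip; rewrite ip; case: ltnP => [/GS//|pi].
  have -> : i = p by apply/eqP; rewrite eqn_leq ip pi.
  exact: addsmxSl.
- by rewrite ltnn; apply: singular_adjoin.
Qed.

(** A vector of [perp X] sent outside [X] would produce, by [isotropic_step], a singular space
    larger than the Witt index allows. *)
Lemma perp_image_max_singular X u : totally_singular b X -> \rank X = nu ->
    hermitian u -> nilpotent_mx u -> (X *m u <= X)%MS ->
  (perp X *m u <= X)%MS.
Proof.
move=> singX rkX herm_u nil_u stabX; apply/stable_rowsP=> y yX.
case: (boolP (_ <= _)%MS) => // yuX.
have [||x [xP xX xx _]] :=
  isotropic_step (nilpotent_set1 nil_u) _ _ yX (erefl u) yuX.
- by move=> v ->.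
- by move=> v ->.
have := witt.2 _ (singular_adjoin singX xP xx).
rewrite leqNgt -rkX rank_ltmx // /ltmx addsmxSl /= addsmx_sub (negPf xX).
by rewrite andbF.
Qed.

(** A nilpotent map acts as zero on the line Y/X. *)
Lemma nilpotent_corank1 X Y u : nilpotent_mx u -> (X <= Y)%MS ->
    \rank Y = (\rank X).+1 -> (X *m u <= X)%MS -> (Y *m u <= Y)%MS ->
  (Y *m u <= X)%MS.
Proof.
move=> nil_u XY rkY stabX stabY.
have /row_subPn[i YiX] : ~~ (Y <= X)%MS.
  by apply/negP=> /mxrankS; rewrite rkY ltnn.
have [||x [xY xX xu]] := @nilpotent_set_step _ _ _ X (fun x => (x <= Y)%MS) _
  (nilpotent_set1 nil_u) _ _ YiX.
- by move=> v x -> xY; apply: submx_trans (submxMr u xY) stabY.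
- exact: row_sub.
apply: submx_trans (submxMr u (submx_adjoin XY rkY xY xX)) _.
by rewrite (eqmxMr _ (addsmxE _ _)) mul_col_mx col_mx_sub stabX xu.
Qed.

(** Here [t] need not be Hermitian, so stability of the orthogonals has to be required
    separately. *)
Definition flag_stable (G : nat -> 'M[F]_n) (t : 'M[F]_n) :=
  forall i, (i <= nu)%N -> (G i *m t <= G i)%MS /\ (perp (G i) *m t <= perp (G i))%MS.

Lemma hermitian_flag_stable G u : hermitian u ->
  (forall i, (i <= nu)%N -> (G i *m u <= G i)%MS) -> flag_stable G u.
Proof. by move=> herm_u Gu i /Gu ?; split=> //; apply: hermitian_perp_stable. Qed.

(* [u] strictly lowers the chain of the [G i] followed by their orthogonals, so
   [u t] is nilpotent. *)
Lemma flag_stable_tr0 G u t : singular_flag nu G -> hermitian u ->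
    nilpotent_mx u -> (forall i, (i <= nu)%N -> (G i *m u <= G i)%MS) ->
  flag_stable G t -> \tr (u *m t) = 0.
Proof.
move=> [rkG GS singG] herm_u nil_u Gu Gt; apply: nilpotent_tr0.
have strict i : (i < nu)%N -> (G i.+1 *m u <= G i)%MS.
  move=> i_lt; have i_le := ltnW i_lt.
  by apply: nilpotent_corank1; rewrite ?rkG ?GS ?Gu.
have G0 : G 0 = 0 by apply/eqP; rewrite -mxrank_eq0 rkG.
set g := u *m t; have g_down i : (i <= nu)%N -> (g ^+ i <= perp (G i))%MS.
  elim: i => [|i IHi] i_le.
    apply/row_subP=> j; apply/perpP=> x; rewrite G0 submx0 => /eqP ->.
    exact: hform0l.
  rewrite exprSr -mulmxE mulmxA.
  apply: submx_trans (submxMr t _) (Gt i.+1 i_le).2.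
  apply: submx_trans (submxMr u (IHi (ltnW i_le))) _.
  apply/stable_rowsP=> y /perpP yP; apply/perpP=> x xG.
  by rewrite -herm_u yP // (submx_trans (submxMr u xG)) ?strict.
have g_mid : (perp (G nu) *m g <= G nu)%MS.
  rewrite mulmxA; apply: submx_trans (submxMr t _) (Gt nu (leqnn _)).1.
  by apply: perp_image_max_singular; rewrite ?rkG ?Gu.
have g_up i : (i <= nu)%N -> (G nu *m g ^+ i <= G (nu - i)%N)%MS.
  elim: i => [|i IHi] i_le; first by rewrite expr0 mulmx1 subn0.
  rewrite exprSr -mulmxE !mulmxA.
  have i_lt : (nu - i.+1 < nu)%N by lia.
  apply: submx_trans (submxMr t _) (Gt _ (ltnW i_lt)).1.
  apply: submx_trans (submxMr u (IHi (ltnW i_le))) _.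
  have -> : (nu - i = (nu - i.+1).+1)%N by lia.
  exact: strict.
(* It takes [nu] factors to reach [perp (G nu)], one to enter [G nu], and [nu] more to descend to
   0. *)
exists (nu + 1 + nu)%N; apply/eqP; rewrite -submx0 !exprD -!mulmxE expr1.
have := g_up nu (leqnn nu); rewrite subnn G0; apply: submx_trans.
apply: submxMr; apply: submx_trans g_mid.
by apply: submxMr; apply: g_down.
Qed.

(** The codimension count is made twice: for [t] on the flag, then for the transpose of [t] on the
    spaces [dual_rows (G i)], whose stability amounts to that of the orthogonals. By singularity
    these lie in the annihilator of [G nu], which the transpose already preserves, so the second
    count takes place in dimension n - nu. *)
Lemma exists_flag_stabilizer G : singular_flag nu G ->
  exists2 D : 'M[F]_(n * n),
    (n * n <= \rank D + nu * (2 * n - 2 * nu - 1))%N &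
    forall t, (mxvec t <= D)%MS -> flag_stable G t.
Proof.
move=> flagG; have [rkG GS singG] := flagG.
have [||D1 [_ rkD1 D1G]] :=
    @codim_flag_stabilizer F n nu _ 1%:M 1%:M G 1%:M rkG GS.
- by move=> i _; apply: submx1.
- by move=> i v _ _; apply: submx1.
have HnuG : dual_rows (G nu) *m (G nu)^T = 0.
  move/singular_sub_perp/sub_kermxP: singG => /(congr1 trmx).
  by rewrite trmx_mul trmxK trmx0.
pose H i := dual_rows (G i).
have HG i : (i <= nu)%N -> H i *m (G nu)^T = 0.
  move=> i_le; have /submxP[c Hc] : (H i <= H nu)%MS.
    by apply/dual_rowsS/(singular_flag_leq flagG); rewrite i_le leqnn.
  by rewrite Hc -mulmxA HnuG mulmx0.
pose T : 'M[F]_(n * n) := lin_mx trmx.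
have TE t : vec_mx (mxvec t *m T) = t^T by rewrite mul_vec_lin mxvecK.
have [||||D [DD1 rkD DH]] :=
    @codim_flag_stabilizer F n nu _ D1 T H (kermx (G nu)^T).
- by move=> i i_le; rewrite rank_dual_rows rkG.
- by move=> i i_lt; apply/dual_rowsS/GS.
- by move=> i i_le; apply/sub_kermxP/HG.
- move=> i w i_le; rewrite -[w]vec_mxK TE => wD1; apply/sub_kermxP.
  have := D1G nu _ (leqnn nu) wD1; rewrite mulmx1 mxvecK => /submxP[c Gc].
  by rewrite -mulmxA -trmx_mul Gc trmx_mul mulmxA HG // mul0mx.
exists D.
  have nu_half := witt_leq_half.
  have nu_le : (nu <= n)%N by lia.
  have nu_le' : (nu <= n - nu)%N by lia.
  move: rkD1 rkD; rewrite !mxrank1 mxrank_ker mxrank_tr rkG // => rkD1 rkD.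
  rewrite -(sum_codim2 nu_half (sum_codim nu_le) (sum_codim nu_le')).
  by rewrite addnA addnAC; apply: leq_trans rkD1 _; rewrite leq_add2r.
move=> t tD i i_le; split.
  have := D1G i _ i_le (submx_trans tD DD1).
  by rewrite mulmx1 mxvecK.
have := DH i _ i_le tD; rewrite TE => /submxP[c Hc].
apply/sub_kermxP; rewrite -mulmxA.
have -> : t *m (dual_rows (G i))^T = (H i *m t^T)^T by rewrite [RHS]trmx_mul trmxK.
by rewrite Hc trmx_mul mulmxA mulmx_ker mul0mx.
Qed.

End WittIndex.
End HermitianForm.

(** * Spaces of nilpotent Hermitian endomorphisms *)

Section FixedSubfield.
Variables (F : fieldType) (conj : {rmorphism F -> F}) (theta : F).
Hypothesis conjK : forall a, conj (conj a) = a.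
Hypothesis theta_moved : conj theta != theta.

Lemma fixed_decomp (c : F) :
  exists a e, [/\ conj a = a, conj e = e & c = a + theta * e].
Proof.
have nz : theta - conj theta != 0 by rewrite subr_eq0 eq_sym.
have nz' : conj theta - theta != 0 by rewrite subr_eq0.
(* Subtracting from c = a + theta e its conjugate forces this value. *)
pose e := (c - conj c) / (theta - conj theta).
have conj_e : conj e = e.
  by rewrite /e rmorphM fmorphV !rmorphB !conjK; field; rewrite nz nz'.
exists (c - theta * e), e; split=> //; last by rewrite subrK.
by rewrite rmorphB rmorphM conj_e /e; field.
Qed.

(** If 0 and 1 were the only fixed elements, [fixed_decomp] would leave at most four elements in
    F. *)
Lemma exists_fixed_not01 : card_gt F 4 ->
  exists a, [/\ conj a = a, a != 0 & a != 1].
Proof.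
case=> s [uniq_s size_s]; apply: NNPP => no_a.
have fixed01 a : conj a = a -> a \in [:: 0; 1].
  move=> fix_a; rewrite !inE; case: (eqVneq a 0) => //= a0.
  by case: (eqVneq a 1) => // a1; case: no_a; exists a.
suff /(uniq_leq_size uniq_s) : {subset s <= [:: 0; 1; theta; 1 + theta]}.
  by rewrite size_s.
move=> c _; have [a [e [/fixed01 + /fixed01 + ->]]] := fixed_decomp c.
rewrite !inE => /orP[] /eqP-> /orP[] /eqP->;
  by rewrite ?(mulr0, mulr1, add0r, addr0) eqxx ?orbT.
Qed.

Variables (n : nat) (b : 'rV[F]_n -> 'rV[F]_n -> F).
Hypothesis sesq : is_sesquilinear conj b.
Hypothesis herm : is_hermitian_form conj b.
Hypothesis nondeg : nondeg_sesq_form b.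
Local Notation hermitian := (b_hermitian_endo b).

Lemma hermitian_sqr u : hermitian u -> hermitian (u *m u).
Proof. by move=> hu x y; rewrite !mulmxA !hu. Qed.

(** Moving h + theta k to the other argument replaces [theta] by its conjugate; the two values
    differ by (theta - conj theta) b(x, y k). *)
Lemma fixed_parts_form h k x y : hermitian h -> hermitian k ->
    b x (y *m (h + theta *: k)) = 0 -> b (x *m (h + theta *: k)) y = 0 ->
  b x (y *m h) = 0 /\ b x (y *m k) = 0.
Proof.
move=> hh hk; rewrite !mulmxDr -!scalemxAr (hformDl sesq) (hformDr sesq).
rewrite (hformZl sesq) (hformZr sesq herm) hh hk => eq1 eq2.
have bk0 : b x (y *m k) = 0.
  apply/eqP; have := congr2 (fun p q => p - q) eq1 eq2; rewrite /=.
  rewrite opprD addrACA subrr add0r -mulrBl subr0 => /eqP.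
  rewrite mulf_eq0 subr_eq0 eq_sym.
  by rewrite (negPf theta_moved).
by move: eq1; rewrite bk0 mulr0 addr0.
Qed.

Lemma fixed_parts_eq0 h k : hermitian h -> hermitian k ->
  h + theta *: k = 0 -> k = 0.
Proof.
move=> hh hk eq0; apply/row_matrixP=> i; rewrite row0 rowE.
apply: nondeg => x.
have [] // := @fixed_parts_form h k x (delta_mx 0 i) hh hk.
  by rewrite eq0 mulmx0 (hform0r sesq herm).
by rewrite eq0 mulmx0 (hform0l sesq).
Qed.

(** Stability of [X] and of [perp X] gives the two vanishing conditions of [fixed_parts_form]; the
    double orthogonal then returns to [X]. *)
Lemma fixed_parts_stable h k (X : 'M[F]_n) : hermitian h -> hermitian k ->
    (X *m (h + theta *: k) <= X)%MS ->
    (perp conj b X *m (h + theta *: k) <= perp conj b X)%MS ->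
  (X *m h <= X)%MS /\ (X *m k <= X)%MS.
Proof.
move=> hh hk /stable_rowsP Xu /stable_rowsP Pu.
have parts x y : (x <= X)%MS -> (y <= perp conj b X)%MS ->
    b x (y *m h) = 0 /\ b x (y *m k) = 0.
  move=> xX yP; apply: fixed_parts_form => //.
    by move/(perpP sesq herm): (Pu y yP); apply.
  by move/(perpP sesq herm): yP; apply; apply: Xu.
split; apply/stable_rowsP=> x xX;
  apply: submx_trans (perp_perp_sub sesq herm nondeg X);
  apply/(perpP sesq herm)=> y yP; apply: (hform_eq0C herm).
  by rewrite hh (parts x y xX yP).1.
by rewrite hk (parts x y xX yP).2.
Qed.

(** * Comparison of freeness over the fixed field and over F *)

Section HermitianSubspace.
Variable S : 'M[F]_n -> Prop.
Hypothesis subS : K_subspace conj S.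
Hypothesis nilS : forall u, S u -> hermitian u /\ nilpotent_mx u.

Lemma fixed_comb d (c : 'I_d -> F) (f : 'I_d -> 'M[F]_n) :
  (forall i, S (f i)) -> (forall i, conj (c i) = c i) ->
  S (\sum_i c i *: f i).
Proof.
move=> Sf fix_c; have [S0 [SD SZ]] := subS.
by apply: big_ind => // i _; apply: SZ.
Qed.

Lemma span_decomp d (c : 'I_d -> F) (f : 'I_d -> 'M[F]_n) :
    (forall i, S (f i)) ->
  exists a e : 'I_d -> F, [/\ forall i, conj (a i) = a i,
    forall i, conj (e i) = e i, forall i, c i = a i + theta * e i &
    \sum_i c i *: f i = \sum_i a i *: f i + theta *: \sum_i e i *: f i].
Proof.
move=> Sf.
have /fin_all_exists[a /fin_all_exists[e ae]] := fun i => fixed_decomp (c i).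
exists a, e; split=> [i|i|i|]; try by case: (ae i).
rewrite scaler_sumr -big_split /=; apply: eq_bigr => i _.
by case: (ae i) => _ _ ->; rewrite scalerDl scalerA.
Qed.

Definition rows_of d (f : 'I_d -> 'M[F]_n) : 'M[F]_(d, n * n) :=
  \matrix_i mxvec (f i).

Lemma rows_of_mul d (f : 'I_d -> 'M[F]_n) (c : 'rV[F]_d) :
  c *m rows_of f = mxvec (\sum_i c 0 i *: f i).
Proof.
rewrite mulmx_sum_row linear_sum; apply: eq_bigr => i _.
by rewrite rowK linearZ.
Qed.

(** A relation over F splits into h + theta k = 0 with [h] and [k] combinations over the fixed
    field, and both vanish by [fixed_parts_eq0]. *)
Lemma K_free_row_free d (f : 'I_d -> 'M[F]_n) :
  (forall i, S (f i)) -> K_free conj f -> row_free (rows_of f).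
Proof.
move=> Sf free_f; rewrite -kermx_eq0; apply/eqP/row_matrixP=> r.
rewrite row0; set c := row r _.
have : c *m rows_of f = 0 by rewrite -row_mul mulmx_ker row0.
have [a [e [fa fe ce sumE]]] := span_decomp (fun i => c 0 i) Sf.
rewrite rows_of_mul sumE => /(congr1 vec_mx); rewrite mxvecK linear0 => sum0.
have hcomb g : (forall i, conj (g i) = g i) -> hermitian (\sum_i g i *: f i).
  by move=> fg; case: (nilS (fixed_comb Sf fg)).
have e0 := fixed_parts_eq0 (hcomb a fa) (hcomb e fe) sum0.
move: sum0; rewrite e0 scaler0 addr0 => a0.
apply/rowP=> i; rewrite ce (free_f a fa a0) (free_f e fe e0).
by rewrite mulr0 addr0 mxE.
Qed.

Lemma K_dim_exists : exists d, K_dim conj S d.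
Proof.
apply: NNPP => no_d.
have big k : exists m (f : 'I_m -> 'M[F]_n),
    [/\ (k <= m)%N, forall i, S (f i) & K_free conj f].
  elim: k => [|k [m [f [km Sf free_f]]]].
    by exists 0, (fun=> 0); split=> // [[]|c _ _ []].
  apply: NNPP => no_m; apply: no_d; exists m; split; first by exists f.
  move=> m' f' Sf' free_f'; rewrite leqNgt; apply/negP=> mm'; apply: no_m.
  by exists m', f'; split=> //; apply: leq_ltn_trans mm'.
have [m [f [ltm Sf free_f]]] := big (n * n).+1.
have := rank_leq_col (rows_of f); rewrite (eqP (K_free_row_free Sf free_f)).
by rewrite leqNgt ltm.
Qed.

(** * The dimension bound and its equality case *)

Section Bound.
Variables (nu : nat) (G : nat -> 'M[F]_n).
Hypothesis witt : witt_index b nu.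
Hypothesis flagG : singular_flag b nu G.
Variables (d : nat) (f : 'I_d -> 'M[F]_n).
Hypothesis Sf : forall i, S (f i).
Hypothesis free_f : row_free (rows_of f).

(** Let [Z] be the orthogonal of J = M + D for the trace form. From M ∩ D <= Z and dim Z = n^2 - dim
    J follows dim M + dim D <= n^2. In the extremal case M ∩ D = Z, so [u] lies in [M], the span of
    [S] over F; being Hermitian, it lies in [S] itself. *)
Lemma dim_bound_and_extremal :
  (d <= nu * (2 * n - 2 * nu - 1))%N /\
  (d = (nu * (2 * n - 2 * nu - 1))%N ->
   forall u, hermitian u -> (forall v, S v -> \tr (u *m v) = 0) ->
     (forall t, flag_stable conj b nu G t -> \tr (u *m t) = 0) -> S u).
Proof.
have [D rkD stabD] := exists_flag_stabilizer sesq herm nondeg witt flagG.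
set M := rows_of f; pose J := (M + D)%MS.
have [S0 [SD SZ]] := subS.
have memM u : (mxvec u <= M)%MS ->
    exists h k, [/\ S h, S k & u = h + theta *: k].
  case/submxP=> c; rewrite rows_of_mul => /(can_inj mxvecK) ->.
  have [a [e [fa fe _ ->]]] := span_decomp (fun i => c 0 i) Sf.
  exists (\sum_i a i *: f i), (\sum_i e i *: f i).
  by split=> //; apply: fixed_comb.
have trS u v : S u -> S v -> \tr (u *m v) = 0.
  move=> Su Sv; have [_ nu_] := nilS Su; have [_ nv_] := nilS Sv.
  by have [_ nuv_] := nilS (SD _ _ Su Sv); have [] := nilpotent_tr_mul nu_ nv_ nuv_.
have tr_lin h k v : \tr (h *m v) = 0 -> \tr (k *m v) = 0 ->
    \tr ((h + theta *: k) *m v) = 0.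
  by move=> h0 k0; rewrite mulmxDl -scalemxAl mxtraceD mxtraceZ h0 k0 mulr0 addr0.
have tr_orth u v : (forall w, S w -> \tr (u *m w) = 0) ->
    (forall t, flag_stable conj b nu G t -> \tr (u *m t) = 0) ->
    (mxvec v <= J)%MS -> \tr (u *m v) = 0.
  move=> uS uD /sub_addsmxP[[c1 c2] /= def_v].
  have -> : v = vec_mx (c1 *m M) + vec_mx (c2 *m D).
    by rewrite -[v]mxvecK def_v linearD.
  rewrite mulmxDr mxtraceD (uD (vec_mx (c2 *m D))) ?addr0; last first.
    by apply: stabD; rewrite vec_mxK submxMl.
  have [|h [k [Sh Sk ->]]] := memM (vec_mx (c1 *m M)).
    by rewrite vec_mxK submxMl.
  by rewrite mxtrace_mulC; apply: tr_lin; rewrite mxtrace_mulC uS.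
(* Such a [u] is h + theta k, and both [h] and [k] stabilise the flag, so [flag_stable_tr0] applies
   to each of them. *)
have tr_cap u v : (mxvec u <= M :&: D)%MS -> (mxvec v <= J)%MS ->
    \tr (u *m v) = 0.
  rewrite sub_capmx => /andP[/memM[h [k [Sh Sk ->]]] /stabD stab_u] vJ.
  have [[hh nh] [hk nk]] := (nilS Sh, nilS Sk).
  have stab_hk i : (i <= nu)%N -> (G i *m h <= G i)%MS /\ (G i *m k <= G i)%MS.
    by move=> i_le; have [] := stab_u i i_le; apply: fixed_parts_stable.
  apply: tr_lin; apply: tr_orth => // [w Sw|t stab_t]; try exact: trS.
    by apply: (flag_stable_tr0 sesq herm witt flagG) stab_t => // i /stab_hk[].
  by apply: (flag_stable_tr0 sesq herm witt flagG) stab_t => // i /stab_hk[].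
(* The trace form is the dot product after transposing one factor, hence this twist before taking a
   kernel. *)
pose T : 'M[F]_(n * n) := lin_mx trmx.
have TT : T *m T = 1%:M.
  apply/row_matrixP=> i; rewrite rowE mulmxA -[delta_mx 0 i]vec_mxK.
  by rewrite !mul_vec_lin /= trmxK vec_mxK rowE mulmx1.
have rkJT : \rank (J *m T) = \rank J.
  apply/eqP; rewrite eqn_leq mxrankM_maxl /= -{1}[J]mulmx1 -TT mulmxA.
  exact: mxrankM_maxl.
pose Z := kermx (J *m T)^T.
have orthZ u : (forall v, (mxvec v <= J)%MS -> \tr (u *m v) = 0) ->
    (mxvec u <= Z)%MS.
  move=> uJ; apply/sub_kermxP/rowP=> i; rewrite [RHS]mxE.
  rewrite -(uJ (vec_mx (row i J))); last by rewrite vec_mxK row_sub.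
  rewrite -mxvec_tr !mxE; apply: eq_bigr => j _; congr (_ * _).
  have -> : mxvec (vec_mx (row i J))^T = row i (J *m T).
    by rewrite row_mul -[row i J in RHS]vec_mxK mul_vec_lin.
  by rewrite [LHS]mxE [RHS]mxE [RHS]mxE.
have capZ : (M :&: D <= Z)%MS.
  apply/row_subP=> i; rewrite -[row i _]vec_mxK; apply: orthZ => v.
  by apply: tr_cap; rewrite vec_mxK row_sub.
have rkZ : \rank Z = (n * n - \rank J)%N by rewrite mxrank_ker mxrank_tr rkJT.
have rkMD := mxrank_sum_cap M D; rewrite -/J (eqP free_f) in rkMD.
have rkJ : (\rank J <= n * n)%N by apply: rank_leq_col.
have rkcap := mxrankS capZ; rewrite rkZ in rkcap.
split.
  by move: rkD rkMD rkJ rkcap; clear; lia.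
move=> dmax u hu uS uD.
have Zcap : (Z <= M :&: D)%MS.
  rewrite -(geq_leqif (mxrank_leqif_sup capZ)) rkZ.
  by move: rkD rkMD rkJ rkcap dmax; clear; lia.
have uZ : (mxvec u <= Z)%MS by apply: orthZ => v; apply: tr_orth.
have uM : (mxvec u <= M)%MS by rewrite (submx_trans uZ) // (submx_trans Zcap) // capmxSl.
have [h [k [Sh Sk def_u]]] := memM u uM.
have [[hh _] [hk _]] := (nilS Sh, nilS Sk).
suff k0 : k = 0 by rewrite def_u k0 scaler0 addr0.
have hhu : hermitian (h - u).
  by move=> x y; rewrite !mulmxBr -!scaleN1r (hformDl sesq) (hformDr sesq)
    (hformZl sesq) (hformZr sesq herm) rmorphN1 hh hu.
by apply: fixed_parts_eq0 hhu hk _; rewrite def_u opprD addrA subrr add0r addNr.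
Qed.

End Bound.
End HermitianSubspace.
End FixedSubfield.

Theorem mainTheorem17 (F : fieldType) (conj : {rmorphism F -> F}) (n : nat)
  (b : 'rV[F]_n -> 'rV[F]_n -> F) (nu : nat) (S : 'M[F]_n -> Prop) :
  nontriv_involution conj ->
  is_sesquilinear conj b -> is_hermitian_form conj b -> nondeg_sesq_form b ->
  witt_index b nu ->
  K_subspace conj S ->
  (forall u, S u -> b_hermitian_endo b u /\ nilpotent_mx u) ->
  (exists d, K_dim conj S d /\ (d <= nu * (2 * n - 2 * nu - 1))%N) /\
  (card_gt F 4 -> K_dim conj S (nu * (2 * n - 2 * nu - 1)) ->
   exists Fl : 'I_nu.+1 -> 'M[F]_n,
     partially_complete_flag Fl /\ totally_singular b (Fl ord_max) /\
     (forall u, S u <-> WH b Fl u)).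
Proof.
move=> [conjK [theta theta_moved]] sesq herm nondeg witt subS nilS.
split.
  have [d dimS] := K_dim_exists conjK theta_moved sesq herm nondeg subS nilS.
  exists d; split=> //; have [[f [Sf free_f]] _] := dimS.
  (* For the bound any maximal singular flag will do; stability under the empty set asks nothing. *)
  have nil0 : nilpotent_set (fun _ : 'M[F]_n => False).
    by exists 1%N => w [u [v []]].
  have [//|G flagG _] := exists_stable_flag sesq herm witt nil0.
  have free_rows := K_free_row_free conjK theta_moved sesq herm nondeg subS nilS Sf free_f.
  by have [] := dim_bound_and_extremal conjK theta_moved sesq herm nondeg subS nilS
    witt flagG Sf free_rows.
move=> cardF dimS; have [[f [Sf free_f]] _] := dimS.
have free_rows := K_free_row_free conjK theta_moved sesq herm nondeg subS nilS Sf free_f.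
have extremal G flagG := (@dim_bound_and_extremal _ _ _ conjK theta_moved _ _ sesq herm nondeg _
  subS nilS _ G witt flagG _ _ Sf free_rows).2 erefl.
have [S0 [SD SZ]] := subS.
have [a [fix_a a0 a1]] := exists_fixed_not01 conjK theta_moved cardF.
have tr_sqr u v : S u -> S v -> \tr (u *m u *m v) = 0.
  move=> Su Sv.
  (* One term is linear in [w] and the other quadratic. Comparing the values at [v] and at [a *: v]
     separates them, as [a] is neither 0 nor 1. *)
  have cubic w : S w -> \tr (u *m u *m w) + \tr (w *m u *m w) = 0.
    move=> Sw; have [[_ nil_u] [_ nil_w]] := (nilS u Su, nilS w Sw).
    have [_ nil_uw] := nilS _ (SD _ _ Su Sw).
    have [_] := nilpotent_tr_mul nil_u nil_w nil_uw.
    by rewrite !mulmxDl mxtraceD.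
  have eq1 := cubic v Sv; have eqa := cubic _ (SZ a v fix_a Sv).
  move: eqa; rewrite -!scalemxAl -!scalemxAr !mxtraceZ.
  move: eq1; set p := \tr _; set q := \tr (v *m u *m v) => eq1 eqa.
  have : a * (1 - a) * p = 0.
    have -> : a * (1 - a) * p = (a * p + a * (a * q)) - a ^+ 2 * (p + q) by ring.
    by rewrite eqa eq1 mulr0 subrr.
  move/eqP; rewrite !mulf_eq0 (negPf a0) subr_eq0 eq_sym (negPf a1) /=.
  by move/eqP.
have S_sqr u : S u -> S (u *m u).
  move=> Su; have [hu nil_u] := nilS u Su.
  (* [extremal] holds for every maximal singular flag, so the flag may be chosen to suit [u]. *)
  have [|G flagG stabG] :=
    exists_stable_flag sesq herm witt (nilpotent_set1 nil_u).
    by move=> v ->.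
  have Gu i : (i <= nu)%N -> (G i *m u <= G i)%MS by apply: stabG.
  apply: (extremal G flagG); first exact: hermitian_sqr.
    by move=> v Sv; apply: tr_sqr.
  move=> t stab_t; apply: (flag_stable_tr0 sesq herm witt flagG) stab_t.
  - exact: hermitian_sqr.
  - case: nil_u => k uk0; exists k.
    by rewrite mulmxE exprMn_comm // uk0 mul0r.
  - by move=> i i_le; rewrite mulmxA (submx_trans (submxMr u (Gu i i_le))) ?Gu.
have jordanS : jordan_closed S.
  move=> u v Su Sv.
  have -> : u *m v + v *m u =
      (u + v) *m (u + v) + (-1) *: (u *m u) + (-1) *: (v *m v).
    rewrite !scaleN1r mulmxDl !mulmxDr [u *m u + u *m v]addrC.
    by rewrite [X in X - v *m v]addrAC addrK addrA addrK.
  have fixN1 : conj (-1) = -1 by rewrite rmorphN1.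
  have SN w : S w -> S ((-1) *: (w *m w)) by move=> Sw; apply/SZ/S_sqr.
  by apply: (SD _ _ (SD _ _ _ (SN u Su)) (SN v Sv)); apply/S_sqr/SD.
have nil_set := jordan_closed_nilpotent jordanS (fun u Su => (nilS u Su).2).
have [|G flagG stabG] := exists_stable_flag sesq herm witt nil_set.
  by move=> u /nilS[].
have [rkG _ singG] := flagG.
exists (fun i => G i); split; first split=> [i|i j ij].
- by rewrite rkG // -ltnS.
- by apply: (singular_flag_leq flagG); rewrite ij -ltnS ltn_ord.
split=> // u; split=> [Su|[nil_u [hu Gu]]].
  have [hu nil_u] := nilS u Su; split=> //; split=> // i.
  by apply: stabG => //; rewrite -ltnS.
have {}Gu i : (i <= nu)%N -> (G i *m u <= G i)%MS.
  by rewrite -ltnS => i_lt; apply: (Gu (Ordinal i_lt)).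
(* [S] itself stabilises the flag and its orthogonals, so [flag_stable_tr0] gives both orthogonality
   conditions. *)
apply: (extremal G flagG) => // [v Sv|t].
  have [hv _] := nilS v Sv.
  apply: (flag_stable_tr0 sesq herm witt flagG) => //.
  by apply: hermitian_flag_stable => // i; apply: stabG.
exact: (flag_stable_tr0 sesq herm witt flagG).
Qed.
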